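(* There are absolute constants $\kappa,K>0$ such that for every concept class $\mathcal C\subseteq\{0,1\}^N$, $$\kappa\,\mathsf Q_{\mathrm{bool}}(\mathcal C)\ \le\ \mathsf Q(\mathcal C)\ \le\ K\,\mathsf Q_{\mathrm{bool}}(\mathcal C),$$ i.e. $\mathsf Q(\mathcal C)=\Theta(\mathsf Q_{\mathrm{bool}}(\mathcal C))$.
   Context: A concept class is a nonempty set $\mathcal C\subseteq\{0,1\}^N$. For a function $f:\mathcal C\to E$ with $E$ a finite set, $\mathsf Q(f)$ denotes its bounded-error quantum query complexity: the minimum number of applications of the unitary $|i,b\rangle\mapsto|i,b\oplus c_i\rangle$ (for $i\in[N]$, $b\in\{0,1\}$; interleaved with arbitrary input-independent unitaries, followed by a measurement) needed by a quantum algorithm that, for every $c\in\mathcal C$ (the promise domain), outputs $f(c)$ with probability at least $2/3$. $\mathsf Q(\mathcal C)$ is the bounded-error quantum query complexity of identifying the unknown concept, i.e. $\mathsf Q(\mathcal C)=\mathsf Q(\mathrm{Id})$ for the identity map $\mathrm{Id}:\mathcal C\to\mathcal C$. For $\mathcal P\subseteq\mathcal C$ let $b_{\mathcal P}:\mathcal C\to\{0,1\}$ be $b_{\mathcal P}(c)=\mathbf 1[c\in\mathcal P]$, and define $\mathsf Q_{\mathrm{bool}}(\mathcal C)=\max_{\mathcal P\subseteq\mathcal C}\mathsf Q(b_{\mathcal P})$. *)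

(* Defs.v *)
From mathcomp Require Import all_boot all_order all_algebra.
From mathcomp Require Import boolp reals.
From mathcomp Require Import complex.

Set Implicit Arguments.
Unset Strict Implicit.
Unset Printing Implicit Defensive.

Import Order.TTheory GRing.Theory Num.Theory.
Local Open Scope ring_scope.
Local Open Scope complex_scope.

Definition concept (N : nat) := {ffun 'I_N -> bool}.

(* Computational basis |i, b, w> : query index, query bit, workspace. *)
Definition basis (N : nat) (W : finType) : finType := ('I_N * bool * W)%type.

(* Operators act on column vectors whose coordinates are numbered by the
   canonical enumeration of the basis. *)
Definition operator (R : realType) (N : nat) (W : finType) :=
  'M[R[i]]_#|basis N W|.

Definition ket (R : realType) (N : nat) (W : finType) (s : basis N W) :
    'cV[R[i]]_#|basis N W| :=
  delta_mx (enum_rank s) 0.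

(* The linear operator sending |s> to |g s>. *)
Definition basis_op (R : realType) (N : nat) (W : finType)
    (g : basis N W -> basis N W) : operator R N W :=
  \matrix_(j, k) (enum_val j == g (enum_val k))%:R.

Definition query_basis (N : nat) (W : finType) (c : concept N)
    (s : basis N W) : basis N W :=
  let: (i, b, w) := s in (i, b (+) c i, w).

Definition query (R : realType) (N : nat) (W : finType) (c : concept N) :
    operator R N W :=
  basis_op R (query_basis c).

(* [qop t] is the unitary applied after the t-th query ([qop 0] before the first
   one).  The number of queries is not part of the algorithm: a T-query run only
   uses [qop 0], ..., [qop T].  The final measurement is in the computational
   basis, the outcome |s> being announced as [qout s]; since the workspace and
   the last unitary are arbitrary, this covers every measurement. *)
Record qalgorithm (R : realType) (N : nat) (W : finType) (E : Type) :=
  QAlgorithm {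
    qinit : basis N W;
    qop : nat -> operator R N W;
    qop_unitary : forall t, qop t \is unitarymx;
    qout : basis N W -> E
  }.

Fixpoint qstate (R : realType) (N : nat) (W : finType) (E : Type)
    (A : qalgorithm R N W E) (c : concept N) (t : nat) :
    'cV[R[i]]_#|basis N W| :=
  if t is t'.+1 then qop A t *m (query R W c *m qstate A c t')
  else qop A 0 *m ket R (qinit A).

Definition output_prob (R : realType) (N : nat) (W : finType) (E : finType)
    (A : qalgorithm R N W E) (T : nat) (c : concept N) (e : E) : R[i] :=
  \sum_(s : basis N W | qout A s == e) `|qstate A c T (enum_rank s) 0| ^+ 2.

Definition computable_with (R : realType) (N : nat) (C : {set concept N})
    (E : finType) (f : {c : concept N | c \in C} -> E) (T : nat) : Prop :=
  exists (W : finType) (A : qalgorithm R N W E),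
    forall c : {c : concept N | c \in C},
      2%:R / 3%:R <= output_prob A T (val c) (f c).

Section Existence.

Variables (R : realType) (n : nat).
Local Notation N := n.+1.

Lemma basis_op_ket (W : finType) (g : basis N W -> basis N W) s :
  basis_op R g *m ket R s = ket R (g s).
Proof.
rewrite /ket -colE; apply/colP => j; rewrite !mxE enum_rankK andbT.
by rewrite -(inj_eq enum_val_inj) enum_rankK.
Qed.

Lemma basis_op_unitary (W : finType) (g : basis N W -> basis N W) :
  injective g -> basis_op R g \is unitarymx.
Proof.
move=> g_inj; apply/unitarymxP/matrixP => j k; rewrite !mxE.
have [g' gK g'K] := injF_bij g_inj.
rewrite (bigD1 (enum_rank (g' (enum_val j)))) //= !mxE enum_rankK g'K eqxx.
rewrite mul1r conjC_nat (inj_eq enum_val_inj) big1 ?addr0; first by rewrite eq_sym.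
move=> l ne_l; rewrite mxE; case: eqP => [gl|_]; last by rewrite mul0r.
by case/eqP: ne_l; rewrite gl gK enum_valK.
Qed.

(* Store the answer bit in cell t of the workspace and move on to the next
   index. *)
Definition store_step (t : nat) (s : basis N (concept N)) :
    basis N (concept N) :=
  let: (i, b, w) := s in
  (ordS i, w (inord t),
   [ffun j => if j == inord t then b else w j]).

Lemma store_step_inj t : injective (store_step t).
Proof.
move=> [[i b] w] [[i' b'] w'] /eqP; rewrite !xpair_eqE.
move=> /andP[/andP[/eqP/ordS_inj -> /eqP ew] /eqP/ffunP ef].
have eb : b = b' by have := ef (inord t); rewrite !ffunE eqxx.
congr (_, _, _) => //; apply/ffunP => j; have := ef j; rewrite !ffunE.
by case: eqP => [->|].
Qed.

Definition read_op (t : nat) : operator R N (concept N) :=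
  if t is t'.+1 then basis_op R (store_step t') else basis_op R id.

Lemma read_op_unitary t : read_op t \is unitarymx.
Proof.
case: t => [|t]; apply: basis_op_unitary => //; exact: store_step_inj.
Qed.

Definition read_alg (E : Type) (out : concept N -> E) :
    qalgorithm R N (concept N) E :=
  {| qinit := (ord0, false, [ffun=> false]);
     qop := read_op;
     qop_unitary := read_op_unitary;
     qout := fun s => out s.2 |}.

Lemma read_algP (E : Type) (out : concept N -> E) (c : concept N) t :
  (t <= N)%N ->
  qstate (read_alg out) c t =
  ket R (inZp t, false, [ffun j : 'I_N => (j < t)%N && c j]).
Proof.
elim: t => [_|t IH lt_tN].
  rewrite /= basis_op_ket; congr ket.
  have -> : inZp 0 = ord0 :> 'I_N by exact: val_inj.
  by congr (_, _); apply/ffunP => j; rewrite !ffunE.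
have -> : qstate (read_alg out) c t.+1 = basis_op R (store_step t) *m
   (query R _ c *m qstate (read_alg out) c t) by [].
rewrite (IH (ltnW lt_tN)) /query !basis_op_ket; congr ket.
have vt : @inord n t = t :> nat by rewrite inordK.
have it : inZp t = inord t :> 'I_N.
  by apply: val_inj; rewrite /= vt modn_small.
rewrite /store_step /query_basis it !ffunE vt ltnn /=.
have -> : ordS (inord t) = inZp t.+1 :> 'I_N by apply: val_inj; rewrite /= vt.
congr (_, _); apply/ffunP => j; rewrite !ffunE ltnS [in RHS]leq_eqVlt.
rewrite -[j == inord t](inj_eq val_inj) /= vt.
by case: eqP => //= ej; congr (c _); apply: val_inj; rewrite /= vt.
Qed.

End Existence.

Lemma computable_with_N (R : realType) (N : nat) (C : {set concept N})
    (E : finType) (f : {c : concept N | c \in C} -> E) :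
  (0 < N)%N -> C != set0 -> computable_with R f N.
Proof.
case: N C f => // n C f _ /set0Pn [c0 c0C].
pose out w := f (insubd (exist _ c0 c0C : {c | c \in C}) w).
exists (concept n.+1), (read_alg R out) => c.
rewrite /output_prob read_algP //.
have -> : [ffun j : 'I_n.+1 => (j < n.+1)%N && val c j] = val c.
  by apply/ffunP => j; rewrite ffunE ltn_ord.
rewrite (bigD1 (inZp n.+1, false, val c)) /=; last by rewrite /out valKd.
rewrite mxE !eqxx normr1 expr1n -[leLHS]addr0; apply: lerD.
  by rewrite ler_pdivrMr ?ltr0n // mul1r ler_nat.
by apply: sumr_ge0 => s _; rewrite exprn_ge0.
Qed.

(* Minimal number of queries.  By [computable_with_N] the default value is only
   reached for an empty promise or for N = 0; in the latter case there is no
   query register, and 0 is the right value since there is only one concept. *)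
Definition Qcomp (R : realType) (N : nat) (C : {set concept N})
    (E : finType) (f : {c : concept N | c \in C} -> E) : nat :=
  if pselect (exists T, `[< computable_with R f T >]) is left exT
  then ex_minn exT else 0%N.

Definition Qclass (R : realType) (N : nat) (C : {set concept N}) : nat :=
  Qcomp R (fun c : {c : concept N | c \in C} => c).

Definition Qbool (R : realType) (N : nat) (C : {set concept N}) : nat :=
  (\max_(P : {set {c : concept N | c \in C}})
     Qcomp R (fun c : {c : concept N | c \in C} => c \in P))%N.

(* Main.v *)
(** Lower bound: an algorithm identifying [c] computes every [b_P] by
    postprocessing its output.

    Upper bound: write [D] for the concepts, and let [A_P] compute [b_P] with
    [T] queries.  Run [A_P], put the sign [-1] on the outcome [true], and run
    [A_P] backwards: the amplitude of returning to the initial state is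
    [(-1) ^ b_P(c) * a] with [1/3 <= a <= 1].  Three rounds of fixed-point
    amplitude amplification bring its real part above [5/6] in absolute value,
    for [54 T] queries.  Applying these circuits in superposition over all
    [P : D -> bool] turns the uniform superposition of the [P] into
    approximately [sum_P (-1) ^ P(c) |P>].  These Hadamard codewords are orthonormal when [c]
    varies, so that undoing the Hadamard transform reveals [c] with probability
    at least [(5/6)^2 > 2/3]. *)
Require Import Defs.
From mathcomp Require Import all_boot all_order all_algebra.
From mathcomp Require Import boolp reals.
From mathcomp Require Import complex ring lra.

Set Implicit Arguments.
Unset Strict Implicit.
Unset Printing Implicit Defensive.

Import Order.TTheory GRing.Theory Num.Theory.
Local Open Scope ring_scope.
Local Open Scope sesquilinear_scope.

(** * Adjoints and unitary matrices *)

Section Adjoint.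

Variable C : numClosedFieldType.

Lemma adjmxM m n p (A : 'M[C]_(m, n)) (B : 'M[C]_(n, p)) :
  (A *m B)^t* = B^t* *m A^t*.
Proof. by rewrite trmx_mul map_mxM. Qed.

Lemma adjmxD m n (A B : 'M[C]_(m, n)) : (A + B)^t* = A^t* + B^t*.
Proof. by rewrite linearD map_mxD. Qed.

Lemma adjmxB m n (A B : 'M[C]_(m, n)) : (A - B)^t* = A^t* - B^t*.
Proof. by rewrite linearB map_mxB. Qed.

Lemma adjmxZ m n a (A : 'M[C]_(m, n)) : (a *: A)^t* = Num.conj a *: A^t*.
Proof. by rewrite linearZ map_mxZ. Qed.

Lemma adjmx1 n : (1%:M : 'M[C]_n)^t* = 1%:M.
Proof. by rewrite trmx1 map_mx1. Qed.

Lemma adjmx_sum m n (I : finType) (A : I -> 'M[C]_(m, n)) :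
  (\sum_i A i)^t* = \sum_i (A i)^t*.
Proof.
apply/matrixP=> i j; rewrite !mxE !summxE rmorph_sum.
by apply: eq_bigr => k _; rewrite !mxE.
Qed.

Lemma unitarymxV n (A : 'M[C]_n) : A \is unitarymx -> A^t* *m A = 1%:M.
Proof. by move=> Au; apply/mulmx1C/unitarymxP. Qed.

Lemma unitarymxZ n a (A : 'M[C]_n) :
  `|a| = 1 -> A \is unitarymx -> a *: A \is unitarymx.
Proof.
move=> a1 /unitarymxP Au; apply/unitarymxP.
by rewrite adjmxZ -scalemxAl -scalemxAr Au scalerA -normCK a1 expr1n scale1r.
Qed.

Lemma unitarymx1 n : (1%:M : 'M[C]_n) \is unitarymx.
Proof. by apply/unitarymxP; rewrite adjmx1 mulmx1. Qed.

End Adjoint.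

(** * One round of fixed-point amplitude amplification *)

Section Amplify.

Variables (C : numClosedFieldType) (n : nat) (v : 'cV[C]_n).
Hypothesis v1 : v^t* *m v = 1%:M.

Definition amplitude (V : 'M[C]_n) : C := (v^t* *m V *m v) 0 0.

Lemma amplitudeE V : v^t* *m V *m v = (amplitude V)%:M.
Proof. exact: mx11_scalar. Qed.

Lemma amplitude_adj V : v^t* *m V^t* *m v = (Num.conj (amplitude V))%:M.
Proof.
rewrite -[v in LHS](trmxCK v) -[X in X *m _]adjmxM -adjmxM trmxCK.
by rewrite mulmxA amplitudeE tr_scalar_mx map_scalar_mx.
Qed.

(* Grover's pi/3 fixed-point search: for [w] a primitive cube root of unity,
   [1 + w] is a primitive sixth root of unity, the phase put on [v]. *)
Definition phase_shift (w : C) : 'M[C]_n := 1%:M + w *: (v *m v^t*).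

Definition amplify (w : C) (V : 'M[C]_n) : 'M[C]_n :=
  w ^+ 2 *: (V *m phase_shift w *m V^t* *m phase_shift w *m V).

Variable w : C.
Hypotheses (w_norm : `|w| = 1) (w_root : 1 + w + w ^+ 2 = 0).

(** Since [v *m v^t*] is a projection and the conjugate of [w] is [w ^+ 2], the cross terms add up
    to [w + w ^+ 2 + w ^+ 3 = 0]. *)
Lemma phase_shift_unitary : phase_shift w \is unitarymx.
Proof.
have w3 : w ^+ 2 * w = 1.
  by apply/subr0_eq; rewrite -[RHS](mul0r (w - 1)) -w_root; ring.
have wC : Num.conj w = w ^+ 2.
  by rewrite -[LHS]mulr1 -w3 mulrCA [_ * w]mulrC -normCK w_norm expr1n mulr1.
apply/unitarymxP; rewrite /phase_shift adjmxD adjmx1 adjmxZ adjmxM trmxCK wC.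
set X := v *m _; have XX : X *m X = X by rewrite /X mulmxA -(mulmxA v) v1 mulmx1.
rewrite mulmxDl mul1mx mulmxDr mulmx1 -scalemxAr -scalemxAl XX scalerA w3.
rewrite -addrA -!scalerDl (_ : _ + _ = 1 + w + w ^+ 2); last by ring.
by rewrite w_root scale0r addr0.
Qed.

Variable V : 'M[C]_n.
Hypothesis Vu : V \is unitarymx.

(** Each phase shift only adds a multiple of [v], so the image of [v] can be followed factor by
    factor. The global phase [w ^+ 2] in [amplify] makes the last factor 1 when the amplitude has
    modulus 1. *)
Lemma amplitude_amplify :
  amplitude (amplify w V)
  = amplitude V * (2 + w ^+ 2 + w * `|amplitude V| ^+ 2).
Proof.
have phaseE p (x : 'M[C]_(n, p)) :
    phase_shift w *m x = x + w *: (v *m (v^t* *m x)).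
  by rewrite /phase_shift mulmxDl mul1mx -scalemxAl mulmxA.
set u := amplitude V.
have w3 : w ^+ 3 = 1.
  by apply/subr0_eq; rewrite -[RHS](mul0r (w - 1)) -w_root; ring.
have e1 : v^t* *m (V *m v) = u%:M by rewrite mulmxA amplitudeE.
have e2 : v^t* *m (V^t* *m v) = (Num.conj u)%:M by rewrite mulmxA amplitude_adj.
have y2 : V^t* *m (phase_shift w *m (V *m v)) = v + (w * u) *: (V^t* *m v).
  rewrite phaseE e1 mul_mx_scalar scalerA mulmxDr mulmxA unitarymxV // mul1mx.
  by rewrite -scalemxAr.
have y3 : phase_shift w *m (v + (w * u) *: (V^t* *m v)) =
    v + (w * u) *: (V^t* *m v) + (w * (1 + w * u * Num.conj u)) *: v.
  rewrite phaseE mulmxDr -scalemxAr e2 v1 scale_scalar_mx -raddfD mul_mx_scalar.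
  by rewrite scalerA.
rewrite {1}/amplitude /amplify -scalemxAr -scalemxAl mxE -!mulmxA y2 y3.
rewrite !mulmxDr -!scalemxAr (mulmxA V) (unitarymxP Vu) mul1mx v1 e1.
rewrite -/u !mxE eqxx !mulr1n normCK.
transitivity (u * (w ^+ 2 + 2 * w ^+ 3 + w ^+ 3 * w * (u * Num.conj u)));
  first by ring.
by rewrite w3; ring.
Qed.

End Amplify.

(** * Matrices of maps between finite bases *)

Section FunctionMatrix.

Variable C : numClosedFieldType.

(** Extends [basis_op] to distinct source and target, so that injections give isometries; for equal
    types the two are convertible. *)
Definition fun_mx (S S' : finType) (g : S -> S') : 'M[C]_(#|S'|, #|S|) :=
  \matrix_(j, k) (enum_val j == g (enum_val k))%:R.

Definition basis_vec (S : finType) (s : S) : 'cV[C]_#|S| :=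
  delta_mx (enum_rank s) 0.

Lemma fun_mx_vec (S S' : finType) (g : S -> S') s :
  fun_mx g *m basis_vec s = basis_vec (g s).
Proof.
rewrite /basis_vec -colE; apply/colP => j; rewrite !mxE enum_rankK andbT.
by rewrite -(inj_eq enum_val_inj) enum_rankK.
Qed.

Lemma eq_on_basis (S : finType) m (A B : 'M[C]_(m, #|S|)) :
  (forall s, A *m basis_vec s = B *m basis_vec s) -> A = B.
Proof.
move=> eqAB; apply/matrixP=> i j; have /colP/(_ i) := eqAB (enum_val j).
by rewrite /basis_vec enum_valK -!colE !mxE.
Qed.

Lemma sum_enum_val (S : finType) (F : S -> C) :
  \sum_(i < #|S|) F (enum_val i) = \sum_s F s.
Proof. by rewrite [RHS](reindex (@enum_val S S)) //; apply/onW_bij/enum_val_bij. Qed.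

Lemma basis_vec_dot (S : finType) (s t : S) :
  (basis_vec s)^t* *m basis_vec t = (s == t)%:R%:M.
Proof.
rewrite /basis_vec trmx_delta map_delta_mx mul_delta_mx_cond (inj_eq enum_rank_inj).
by apply/matrixP=> i j; rewrite !ord1 !mxE mulr1n; case: eqP => _; rewrite !mxE.
Qed.

Lemma fun_mx_adj_mul (S S' S'' : finType) (g : S -> S'') (h : S' -> S'') i j :
  ((fun_mx g)^t* *m fun_mx h) i j = (g (enum_val i) == h (enum_val j))%:R.
Proof.
rewrite mxE (bigD1 (enum_rank (g (enum_val i)))) //= !mxE enum_rankK eqxx.
rewrite conjC_nat mul1r big1 ?addr0 // => k; rewrite !mxE -(inj_eq enum_val_inj).
by rewrite enum_rankK => /negPf->; rewrite conjC0 mul0r.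
Qed.

Lemma fun_mx_isometry (S S' : finType) (g : S -> S') :
  injective g -> (fun_mx g)^t* *m fun_mx g = 1%:M.
Proof.
move=> g_inj; apply/matrixP=> i j; rewrite fun_mx_adj_mul mxE.
by rewrite (inj_eq g_inj) (inj_eq enum_val_inj).
Qed.

Lemma fun_mx_orthogonal (S S' S'' : finType) (g : S -> S'') (h : S' -> S'') :
  (forall s s', g s != h s') -> (fun_mx g)^t* *m fun_mx h = 0.
Proof.
by move=> gh; apply/matrixP=> i j; rewrite fun_mx_adj_mul mxE (negPf (gh _ _)).
Qed.

End FunctionMatrix.

(** * Query circuits and their closure properties *)

Section Circuit.

Variables (R : realType) (N : nat) (W : finType).
Implicit Types (c : concept N) (u : nat -> operator R N W).

Fixpoint run u c (t : nat) : operator R N W :=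
  if t is t'.+1 then u t *m (query R W c *m run u c t') else u 0.

(** The unitaries are fixed before the input is given; [U] records the overall operator on each
    input. *)
Definition circuit (T : nat) (U : concept N -> operator R N W) :=
  exists2 u, forall t, u t \is unitarymx & forall c, run u c T = U c.

Lemma qstateE (E : Type) (A : qalgorithm R N W E) c t :
  qstate A c t = run (qop A) c t *m ket R (qinit A).
Proof. by elim: t => //= t ->; rewrite !mulmxA. Qed.

Lemma eq_run u u' c T :
  (forall t, (t <= T)%N -> u t = u' t) -> run u c T = run u' c T.
Proof.
elim: T => [|T IH] uu' /=; first exact: uu'.
by rewrite uu' // IH // => t le_tT; exact/uu'/leqW.
Qed.

Lemma query_basisK c : involutive (@query_basis N W c).
Proof. by move=> [[i b] w] /=; rewrite -addbA addbb addbF. Qed.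

Lemma query_unitary c : query R W c \is unitarymx.
Proof.
by apply/unitarymxP/mulmx1C/fun_mx_isometry/inv_inj/query_basisK.
Qed.

Lemma query_adj c : (query R W c)^t* = query R W c.
Proof.
apply/matrixP=> i j; rewrite !mxE conjC_nat; congr (nat_of_bool _)%:R.
by rewrite -(inj_eq (inv_inj (query_basisK c))) query_basisK eq_sym.
Qed.

Lemma circuit0 V : V \is unitarymx -> circuit 0 (fun=> V).
Proof. by move=> Vu; exists (fun=> V). Qed.

Lemma circuitS T U V : V \is unitarymx -> circuit T U ->
  circuit T.+1 (fun c => V *m (query R W c *m U c)).
Proof.
move=> Vu [u uu uU]; exists (fun t => if t == T.+1 then V else u t) => [t|c].
  by case: (t == _); [exact: Vu | exact: uu].
rewrite /= eqxx -uU; congr (_ *m (_ *m _)); apply: eq_run => t le_tT.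
by rewrite ltn_eqF.
Qed.

Lemma circuit_unitary T U c : circuit T U -> U c \is unitarymx.
Proof.
case=> u uu <-; elim: T => [|T IH]; first exact: uu.
exact: mul_unitarymx (uu _) (mul_unitarymx (query_unitary c) IH).
Qed.

Lemma eq_circuit T U U' : (forall c, U c = U' c) -> circuit T U -> circuit T U'.
Proof. by move=> UU' [u uu uU]; exists u => // c; rewrite uU. Qed.

(** The first unitary of [U] is absorbed into the last one of [V], so query counts add exactly. *)
Lemma circuitM T T' U V :
  circuit T U -> circuit T' V -> circuit (T + T') (fun c => U c *m V c).
Proof.
move=> [u uu uU] cV; suff: circuit (T + T') (fun c => run u c T *m V c).
  by apply: eq_circuit => c; rewrite uU.
elim: T {U uU} => [|T IH] /=; last first.
  rewrite addSn; apply: eq_circuit (circuitS (uu T.+1) IH) => c.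
  by rewrite !mulmxA.
case: T' V cV => [|T'] V [v vu vV].
  exists (fun=> u 0 *m v 0) => [t|c]; first exact: mul_unitarymx.
  by rewrite -vV.
have cV : circuit T' (fun c => run v c T') by exists v.
have := circuitS (mul_unitarymx (uu 0) (vu T'.+1)) cV.
by apply: eq_circuit => c; rewrite -vV /= !mulmxA.
Qed.

Lemma circuitMl T U V :
  V \is unitarymx -> circuit T U -> circuit T (fun c => V *m U c).
Proof. by move=> Vu; apply: circuitM (circuit0 Vu). Qed.

Lemma circuitMr T U V :
  V \is unitarymx -> circuit T U -> circuit T (fun c => U c *m V).
Proof. by move=> Vu /circuitM/(_ (circuit0 Vu)); rewrite addn0. Qed.

(** A query is its own adjoint, so running backwards costs no extra query. *)
Lemma circuit_adj T U : circuit T U -> circuit T (fun c => (U c)^t*).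
Proof.
case=> u uu uU; suff: circuit T (fun c => (run u c T)^t*).
  by apply: eq_circuit => c; rewrite uU.
elim: T {U uU} => [|T IH] /=; first by apply: circuit0; rewrite trmxC_unitary.
have uTu : (u T.+1)^t* \is unitarymx by rewrite trmxC_unitary.
have := circuitM IH (circuitS (unitarymx1 _ _) (circuit0 uTu)).
rewrite addn1; apply: eq_circuit => c.
by rewrite [in RHS]adjmxM adjmxM query_adj mul1mx mulmxA.
Qed.

(** [amplify] uses [U c] twice and its adjoint once; the phase shifts do not query. *)
Lemma circuit_amplify T U v w :
  v^t* *m v = 1%:M -> `|w| = 1 -> 1 + w + w ^+ 2 = 0 ->
  circuit T U -> circuit (3 * T) (fun c => amplify v w (U c)).
Proof.
move=> v1 w1 w0 cU; rewrite mulSn mul2n -addnn addnA.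
have Su := phase_shift_unitary v1 w1 w0.
have wu : w ^+ 2 *: (1%:M : operator R N W) \is unitarymx.
  by apply: unitarymxZ (unitarymx1 _ _); rewrite normrX w1 expr1n.
have := circuitM (circuitMr Su (circuitM (circuitMr Su cU) (circuit_adj cU))) cU.
move/(circuitMl wu); apply: eq_circuit => c.
by rewrite -scalemxAl mul1mx.
Qed.

End Circuit.

(** * The real inequality behind three rounds of amplification *)

Section FixedPointIteration.

Variable R : realType.

(** Serves to eliminate the square root [a] of [1 - x]: only [a ^+ 2] and a simple lower bound [L]
    of [H] remain. *)
Lemma le_mul_of_sqr (a b L H : R) :
  0 <= a -> 0 <= L -> L <= H -> b ^+ 2 <= a ^+ 2 * L ^+ 2 -> b <= a * H.
Proof.
move=> a0 L0 LH bL; apply: le_trans (ler_wpM2l a0 LH).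
apply: le_trans (ler_norm b) _.
by rewrite -ler_sqr ?nnegrE ?mulr_ge0 // real_normK ?num_real // exprMn.
Qed.

(** A convex function lies above its tangent at [t]; here the gap is [(x - t) ^+ 2] times a
    polynomial with nonnegative coefficients. *)
Lemma quartic_tangent (t x : R) : 0 <= t -> 0 <= x ->
  4 * t ^+ 3 + 8 * t ^+ 4 + (12 * t ^+ 2 + 32 * t ^+ 3) * (x - t)
  <= 4 * x ^+ 3 + 8 * x ^+ 4.
Proof.
move=> t0 x0; rewrite -subr_ge0.
rewrite [leRHS](_ : _ = (x - t) ^+ 2 *
  (8 * x ^+ 2 + (16 * t + 4) * x + (24 * t ^+ 2 + 8 * t))); last by ring.
by rewrite mulr_ge0 ?sqr_ge0 // !addr_ge0 ?mulr_ge0 ?addr_ge0 ?exprn_ge0 ?mulr_ge0.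
Qed.

(* On each piece the second factor is bounded below by an affine function, and
   the claim becomes a cubic inequality after squaring. *)
Lemma iterate3_bound (a : R) (x := 1 - a ^+ 2) (y := x ^+ 3) (z := y ^+ 3) :
  3^-1 <= a -> a <= 1 ->
  20 / 3 <= a * ((2 + z) * (4 + 2 * x + 2 * y + 4 * x * y) + 6 * z * (y - x)).
Proof.
move=> a3 a1; have a0 : 0 <= a by lra.
have a2 : a ^+ 2 = 1 - x by rewrite /x; ring.
have x0 : 0 <= x by rewrite /x; nra.
have x89 : x <= 8 / 9 by rewrite /x; nra.
set H := _ + _.
have HE : H = 8 + 4 * x + (4 * x ^+ 3 + 8 * x ^+ 4)
            + z * (4 * (1 - x) + 8 * y + 4 * x * y).
  by rewrite /H /z /y; ring.
(* The increasing factors are bounded by their values at [l]; the decreasing [4 * (1 - x)] is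
   replaced by its minimum 4/9, reached at [x = 8 / 9]. *)
have rest l : 0 <= l -> l <= x ->
    (l ^+ 3) ^+ 3 * (4 / 9 + 8 * l ^+ 3 + 4 * l * l ^+ 3)
    <= z * (4 * (1 - x) + 8 * y + 4 * x * y).
  move=> l0 lx; have ly : l ^+ 3 <= y by rewrite lerXn2r ?nnegrE.
  have l3 : 0 <= l ^+ 3 by rewrite exprn_ge0.
  apply: ler_pM; rewrite ?exprn_ge0 //.
  - by have := mulr_ge0 l0 l3; lra.
  - by rewrite lerXn2r ?nnegrE // exprn_ge0.
  - have : 4 * l * l ^+ 3 <= 4 * x * y by apply: ler_pM; rewrite ?mulr_ge0 //; lra.
    by lra.
have sq2 (c d : R) : 0 <= c + d * x -> c + d * x <= H ->
    (20 / 3) ^+ 2 <= (1 - x) * (c + d * x) ^+ 2 -> 20 / 3 <= a * H.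
  by move=> L0 LH; rewrite -a2; apply: le_mul_of_sqr.
(* The first piece uses the affine bound [8 + 4 * x]. On the others the coefficients are rounded
   down from [8 + 4 * x] plus a tangent, at 7/10 or 17/20, plus the constant given by [rest]. *)
have [x1|x1] := leP x (11 / 20).
  have := rest 0 (lexx _) x0.
  have : 0 <= 4 * x ^+ 3 + 8 * x ^+ 4 by rewrite addr_ge0 ?mulr_ge0 ?exprn_ge0.
  by move=> h1 h2; apply: (sq2 8 4); [lra|lra|nra].
have [x2|x2] := leP x (4 / 5).
  have := rest 0 (lexx _) x0.
  have := @quartic_tangent (7 / 10) x; move=> /(_ ltac:(lra) x0) h1 h2.
  by apply: (sq2 (- (51 / 100)) (2085 / 100)); [lra|lra|nra].
have := @quartic_tangent (17 / 20) x; move=> /(_ ltac:(lra) x0) h1.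
have [x3|x3] := leP x (17 / 20).
  have := rest (4 / 5) ltac:(lra) (ltW x2) => h2.
  by apply: (sq2 (- (87 / 10)) (323 / 10)); [lra|lra|nra].
have := rest (17 / 20) ltac:(lra) (ltW x3) => h2.
by apply: (sq2 (- (78 / 10)) (323 / 10)); [lra|lra|nra].
Qed.

End FixedPointIteration.

(** * Amplitudes under alternating cube roots of unity *)

Section CubeRoot.

Variable R : realType.

Definition omega : R[i] := (- (1 / 2) +i* (Num.sqrt 3 / 2))%C.

Let sqrt3 : Num.sqrt 3 ^+ 2 = 3 :> R.
Proof. by rewrite sqr_sqrtr. Qed.

Lemma omega_root : 1 + omega + omega ^+ 2 = 0.
Proof.
apply/eqP; rewrite expr2 eq_complex /= /omega; apply/andP; split; apply/eqP => /=.
- by have := sqrt3; set s := Num.sqrt _ => s2; field: s2.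
- by field.
Qed.

Lemma omega_norm : `|omega| = 1.
Proof.
apply/eqP; rewrite -(@eqrXn2 _ 2) // expr1n -add_Re2_Im2 /=.
rewrite (_ : _ + _ = 1) //.
by have := sqrt3; set s := Num.sqrt _ => s2; field: s2.
Qed.

Lemma conj_omega_root : 1 + (omega^*)%C + (omega^*)%C ^+ 2 = 0.
Proof. by rewrite -(rmorph1 (@conjc R)) -rmorphXn -!rmorphD omega_root rmorph0. Qed.

Lemma conj_omega_norm : `|(omega^*)%C| = 1.
Proof. by rewrite normcJ omega_norm. Qed.

Definition iterate (w u : R[i]) : R[i] := u * (2 + w ^+ 2 + w * `|u| ^+ 2).

(** As [1 + omega + omega ^+ 2 = 0], the factor collapses to [1 - omega * x]. *)
Lemma iterate_omega (u : R[i]) x : `|u| ^+ 2 = (1 - x)%:C%C ->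
  iterate omega u = u * ((2 + x) / 2 -i* (Num.sqrt 3 / 2 * x))%C.
Proof.
rewrite /iterate => ->; congr (u * _); apply/eqP.
rewrite expr2 eq_complex /=; apply/andP; split; apply/eqP => /=;
  by have := sqrt3; set s := Num.sqrt _ => s2; field: s2.
Qed.

Lemma iterate_conj_omega (u : R[i]) x : `|u| ^+ 2 = (1 - x)%:C%C ->
  iterate (omega^*)%C u = u * ((2 + x) / 2 +i* (Num.sqrt 3 / 2 * x))%C.
Proof.
rewrite /iterate => ->; congr (u * _); apply/eqP.
rewrite expr2 eq_complex /=; apply/andP; split; apply/eqP => /=;
  by have := sqrt3; set s := Num.sqrt _ => s2; field: s2.
Qed.

(* The failure probability [x] is cubed, whichever cube root is used. *)
Lemma norm_iterate (u g : R[i]) x : `|u| ^+ 2 = (1 - x)%:C%C ->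
  g = ((2 + x) / 2 -i* (Num.sqrt 3 / 2 * x))%C \/
  g = ((2 + x) / 2 +i* (Num.sqrt 3 / 2 * x))%C ->
  `|u * g| ^+ 2 = (1 - x ^+ 3)%:C%C.
Proof.
move=> ux gE; rewrite normrM exprMn ux.
have -> : `|g| ^+ 2 = (1 + x + x ^+ 2)%:C%C.
  rewrite -add_Re2_Im2; congr (_%:C)%C.
  by case: gE => -> /=; have := sqrt3; set s := Num.sqrt _ => s2; field: s2.
by rewrite -rmorphM; congr (_%:C)%C; ring.
Qed.

(* A round also rotates the amplitude by an angle depending on [x]; alternating
   [omega] with its conjugate makes successive rotations cancel partially, so
   that the real part stays large. *)
Lemma Re_iterate3 (a : R) (x := 1 - a ^+ 2) (y := x ^+ 3) (z := y ^+ 3) :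
  complex.Re (iterate omega (iterate (omega^*)%C (iterate omega a%:C%C)))
  = a * ((2 + z) * (4 + 2 * x + 2 * y + 4 * x * y) + 6 * z * (y - x)) / 8.
Proof.
have n0 : `|a%:C%C| ^+ 2 = (1 - x)%:C%C.
  by rewrite -add_Re2_Im2 /= expr0n addr0 /x subKr.
have n1 := norm_iterate n0 (or_introl erefl).
have n2 := norm_iterate n1 (or_intror erefl).
rewrite (iterate_omega n0) (iterate_conj_omega n1) (iterate_omega n2) -/y -/z /=.
by have := sqrt3; set s := Num.sqrt _ => s2; field: s2.
Qed.

(** The formula of [Re_iterate3] is odd in [a], so the sign carrying the Boolean answer survives
    amplification. *)
Lemma Re_iterate3_ge (b : bool) (a : R) : 3^-1 <= (-1) ^+ b * a <= 1 ->
  5 / 6 <= (-1) ^+ b *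
    complex.Re (iterate omega (iterate (omega^*)%C (iterate omega a%:C%C))).
Proof.
have sgn2 : (a : R) ^+ 2 = ((-1) ^+ b * a) ^+ 2 by rewrite exprMn sqrr_sign mul1r.
move=> /andP[a3 a1]; have := iterate3_bound a3 a1; rewrite -sgn2 => H.
by rewrite Re_iterate3 -!mulrA; lra.
Qed.

End CubeRoot.

(** * From a Boolean algorithm to a signed return amplitude *)

Section BooleanCircuit.

Variables (R : realType) (N : nat).

(* Two consecutive queries cancel each other. *)
Lemma circuit_pad (W : finType) T k (U : concept N -> operator R N W) :
  circuit T U -> circuit (2 * k + T) U.
Proof.
elim: k => [|k IH] // /IH cU; rewrite mulnS -addnA.
have c1 := circuit0 (unitarymx1 R[i] #|basis N W|).
have := circuitM (circuitS (unitarymx1 _ _) (circuitS (unitarymx1 _ _) c1)) cU.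
apply: eq_circuit => c; rewrite mulmx1 !mul1mx -{1}(query_adj R W c).
by rewrite (unitarymxV (query_unitary R W c)) mul1mx.
Qed.

Definition sign_mx (S : finType) (h : pred S) : 'M[R[i]]_#|S| :=
  diag_mx (\row_j (-1) ^+ h (enum_val j)).

Lemma sign_mx_unitary (S : finType) (h : pred S) : sign_mx h \is unitarymx.
Proof.
apply/unitarymxP; rewrite /sign_mx tr_diag_mx map_diag_mx mulmx_diag.
rewrite -diag_const_mx; congr diag_mx; apply/rowP => j.
by rewrite !mxE rmorph_sign -expr2 sqrr_sign.
Qed.

(** The return amplitude is the expectation of the sign under the measurement distribution of
    [U *m v]; in particular it is real. *)
Lemma amplitude_sign_mx (S : finType) (h : pred S) (U : 'M[R[i]]_#|S|) v :
  amplitude v (U^t* *m sign_mx h *m U) =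
  \sum_s (-1) ^+ h s * `|(U *m v) (enum_rank s) 0| ^+ 2.
Proof.
rewrite /amplitude !mulmxA -adjmxM -mulmxA; set x := U *m v.
rewrite -mulmxA mul_diag_mx mxE -[RHS]sum_enum_val; apply: eq_bigr => j _.
rewrite !mxE enum_valK normCK.
by rewrite mulrCA; congr (_ * _); apply: mulrC.
Qed.

Lemma norm_unitary (S : finType) (U : 'M[R[i]]_#|S|) (v : 'cV_#|S|) :
  U \is unitarymx -> v^t* *m v = 1%:M ->
  \sum_s `|(U *m v) (enum_rank s) 0| ^+ 2 = 1.
Proof.
move=> Uu v1.
have e : (U *m v)^t* *m (U *m v) = 1%:M.
  by rewrite adjmxM -mulmxA (mulmxA _ U) unitarymxV // mul1mx v1.
transitivity (((U *m v)^t* *m (U *m v)) 0 0); last by rewrite e mxE.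
rewrite [RHS]mxE -[LHS]sum_enum_val; apply: eq_bigr => j _.
by rewrite enum_valK [in RHS]mxE [in RHS]mxE normCK mulrC.
Qed.

Lemma boolean_circuit (C : {set concept N}) (f : {c | c \in C} -> bool) T :
  computable_with R f T ->
  exists (W : finType) (s : basis N W) (U : concept N -> operator R N W),
    circuit (54 * T) U /\
    forall c, 5 / 6 <= (-1) ^+ f c *
      complex.Re (amplitude (basis_vec R[i] s) (U (val c))).
Proof.
case=> W [A Af]; set v := basis_vec R[i] (qinit A).
have v1 : v^t* *m v = 1%:M by rewrite basis_vec_dot eqxx.
have cU : circuit T (fun c => run (qop A) c T).
  by exists (qop A) => //; apply: qop_unitary.
set Z := sign_mx (qout A).
pose V0 c := (run (qop A) c T)^t* *m Z *m run (qop A) c T.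
have c0 : circuit (2 * T) V0.
  rewrite mul2n -addnn; apply: (circuitM _ cU).
  exact: circuitMr (sign_mx_unitary _) (circuit_adj cU).
have w1 := omega_norm R; have w0 := omega_root R.
have w1' := conj_omega_norm R; have w0' := conj_omega_root R.
(* Each round triples the [2 * T] queries of [V0], whence [3 * 3 * 3 * 2 = 54]. *)
have c1 := circuit_amplify v1 w1 w0 c0.
have c2 := circuit_amplify v1 w1' w0' c1.
have c3 := circuit_amplify v1 w1 w0 c2.
exists W, (qinit A); eexists; split; first by rewrite !mulnA in c3; exact: c3.
move=> c.
rewrite (amplitude_amplify v1 w0 (circuit_unitary _ c2)).
rewrite (amplitude_amplify v1 w0' (circuit_unitary _ c1)).
rewrite (amplitude_amplify v1 w0 (circuit_unitary _ c0)).
rewrite -!/(iterate _ _).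
set a := amplitude v _.
pose p b := output_prob A T (val c) b.
have pge0 b : 0 <= p b by apply: sumr_ge0 => s _; rewrite exprn_ge0.
have pE b : p b = \sum_(s | qout A s == b)
    `|(run (qop A) (val c) T *m v) (enum_rank s) 0| ^+ 2.
  by rewrite /p /output_prob qstateE.
have p1 : p (f c) + p (~~ f c) = 1.
  rewrite !pE -(norm_unitary (circuit_unitary (val c) cU) v1).
  rewrite [RHS](bigID (fun s => qout A s == f c)) /=; congr (_ + _).
  by apply: eq_bigl => s; case: (qout A s) (f c) => [] [].
have pN : p (~~ f c) = 1 - p (f c) by rewrite -p1 addrAC subrr add0r.
have aE : a = (-1) ^+ f c * (2 * p (f c) - 1).
  rewrite /a amplitude_sign_mx (bigID (fun s => qout A s == f c)) /=.
  set w := fun s => `|(run (qop A) (val c) T *m v) (enum_rank s) 0| ^+ 2.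
  rewrite (eq_bigr (fun s => (-1) ^+ f c * w s)); last by move=> s /eqP->.
  rewrite [X in _ + X](eq_bigr (fun s => (-1) ^+ (~~ f c) * w s)); last first.
    by move=> s; case: (qout A s) (f c) => [] [].
  rewrite -!mulr_sumr /w -pE [X in _ + _ * X](_ : _ = p (~~ f c)); last first.
    by rewrite pE; apply: eq_bigl => s; case: (qout A s) (f c) => [] [].
  by rewrite pN signrN; ring.
(* Probabilities are elements of [R[i]]; [Re_iterate3_ge] needs them as reals. *)
have pR b : p b = (complex.Re (p b))%:C%C by rewrite RRe_real // ger0_real.
have p_le1 : complex.Re (p (f c)) <= 1.
  by rewrite -lecR -pR (_ : 1%:C%C = 1) // -p1 lerDl pge0.
have p_ge : 2 / 3 <= complex.Re (p (f c)).
  by rewrite -lecR -pR rmorphM fmorphV !rmorph_nat; apply: Af.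
set q := complex.Re _ in p_le1 p_ge.
have -> : a = ((-1) ^+ f c * (2 * q - 1))%:C%C.
  by rewrite aE pR -/q rmorphM rmorphB rmorphM rmorph1 rmorph_nat rmorph_sign.
apply: Re_iterate3_ge; rewrite mulrA -expr2 sqrr_sign mul1r.
by apply/andP; split; lra.
Qed.

End BooleanCircuit.

(** * Extending a unitary along an isometry *)

Section UnitaryExtension.

Variables (C : numClosedFieldType) (m n : nat).
Variables (J : 'M[C]_(n, m)) (F : 'M[C]_m).
Hypothesis J1 : J^t* *m J = 1%:M.

(** A copy of [F] on the range of [J], and the identity on the orthogonal complement. *)
Definition extend_mx : 'M[C]_n := 1%:M - J *m J^t* + J *m F *m J^t*.

Lemma extend_mxE : extend_mx *m J = J *m F.
Proof.
rewrite /extend_mx mulmxDl mulmxBl mul1mx -!(mulmxA _ (J^t*)) J1 !mulmx1.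
by rewrite subrr add0r.
Qed.

Lemma extend_mx_unitary : F \is unitarymx -> extend_mx \is unitarymx.
Proof.
move=> /unitarymxP F1; apply/unitarymxP.
have -> : extend_mx^t* = 1%:M - J *m J^t* + J *m F^t* *m J^t*.
  by rewrite adjmxD adjmxB adjmx1 !adjmxM trmxCK mulmxA.
rewrite mulmxDr mulmxBr mulmx1 !mulmxA extend_mxE -(mulmxA J F (F^t*)) F1 mulmx1.
by rewrite /extend_mx addrK subrK.
Qed.

End UnitaryExtension.

(** * The Hadamard transform on predicates *)

Section Hadamard.

Variables (C : numClosedFieldType) (D : finType).
Implicit Types p q : {ffun D -> bool}.

Let h (a b : bool) : C := (-1) ^+ (a && b) / sqrtC 2.

Let h_conj a b : Num.conj (h a b) = h a b.
Proof.
apply: conj_Creal; rewrite rpredM ?rpredX ?rpredN1 // realV.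
by rewrite ger0_real // sqrtC_ge0.
Qed.

Let hh a b a' b' :
  h a b * Num.conj (h a' b') = (-1) ^+ (a && b) * (-1) ^+ (a' && b') / 2.
Proof. by rewrite h_conj /h mulrACA -invfM -expr2 sqrtCK. Qed.

Definition hadamard : 'M[C]_#|{ffun D -> bool}| :=
  \matrix_(i, j) \prod_d h ((enum_val i : {ffun D -> bool}) d)
                          ((enum_val j : {ffun D -> bool}) d).

(** The sum over predicates distributes into a product over [D] of orthogonality relations for the
    two-by-two Hadamard matrix. *)
Lemma hadamard_unitary : hadamard \is unitarymx.
Proof.
apply/unitarymxP/matrixP=> i j; rewrite mxE.
set p := enum_val i; set q := enum_val j.
transitivity (\sum_(r : {ffun D -> bool})
    \prod_d (h (p d) (r d) * Num.conj (h (q d) (r d)))).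
  rewrite -[RHS]sum_enum_val; apply: eq_bigr => k _.
  by rewrite !mxE rmorph_prod -big_split.
rewrite -(bigA_distr_bigA (fun d b => h (p d) b * Num.conj (h (q d) b))) mxE.
have hE d : \sum_b h (p d) b * Num.conj (h (q d) b) = (p d == q d)%:R.
  rewrite big_bool !hh; case: (p d) (q d) => [] [] /=;
  by rewrite ?expr0 ?expr1 ?mulrNN ?mulr1 ?mul1r; field.
rewrite (eq_bigr _ (fun d _ => hE d)) -(inj_eq enum_val_inj) -/p -/q.
have [->|/eqP pq] := eqVneq p q; first by rewrite big1 // => d _; rewrite eqxx.
have /existsP[d pqd] : [exists d, p d != q d].
  by rewrite -negb_forall; apply/negP=> /forallP H; apply/pq/ffunP=> d; apply/eqP.
by rewrite (bigD1 d) //= (negPf pqd) mul0r.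
Qed.

(** Column [z] is the uniform superposition; column [e] is the normalized codeword of [c]. *)
Lemma hadamard_mul_conj p (c : D) :
  let z : {ffun D -> bool} := [ffun=> false] in
  let e : {ffun D -> bool} := [ffun d => d == c] in
  Num.conj (hadamard (enum_rank p) (enum_rank e)) *
  hadamard (enum_rank p) (enum_rank z) = (-1) ^+ p c / #|{ffun D -> bool}|%:R.
Proof.
move=> z e; rewrite mulrC !mxE !enum_rankK rmorph_prod -big_split /=.
under eq_bigr => d _ do rewrite hh !ffunE andbF mul1r.
rewrite prodf_div prodr_const card_ffun card_bool natrX; congr (_ / _).
by rewrite (bigD1 c) //= eqxx andbT big1 ?mulr1 // => d /negPf->; rewrite andbF.
Qed.

End Hadamard.

(** * Controlled circuits with branch-dependent workspaces *)

Section Blocks.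

Variables (R : realType) (N : nat) (I : finType) (W : I -> finType).
Local Notation blocks := {p : I & W p}.

(** The control register is the tag of a dependent pair, since workspaces vary with [p]; all
    branches share the query register. *)
Definition embed p (b : basis N (W p)) : basis N blocks := (b.1, Tagged W b.2).

Local Notation E p := (fun_mx R[i] (@embed p)).

Lemma embed_inj p : injective (@embed p).
Proof. by move=> [ib w] [ib' w'] [-> /eqP]; rewrite eq_Tagged => /eqP /= ->. Qed.

Lemma embed_tag p q (b : basis N (W p)) (b' : basis N (W q)) :
  embed b = embed b' -> p = q.
Proof. by move/(congr1 (fun x => tag x.2)). Qed.

Lemma embed_isometry p : (E p)^t* *m E p = 1%:M.
Proof. exact/fun_mx_isometry/embed_inj. Qed.

Lemma embed_orthogonal p q : p != q -> (E p)^t* *m E q = 0.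
Proof.
move=> /eqP npq; apply: fun_mx_orthogonal => b b'.
by apply/eqP => /embed_tag.
Qed.

Lemma eq_on_blocks m (A B : 'M[R[i]]_(m, _)) :
  (forall p, A *m E p = B *m E p) -> A = B.
Proof.
move=> eqAB; apply: eq_on_basis => -[ib [p w]].
by rewrite -[(ib, _)]/(embed (ib, w)) -fun_mx_vec !mulmxA eqAB.
Qed.

Definition block (M : forall p, operator R N (W p)) : operator R N blocks :=
  \sum_p E p *m M p *m (E p)^t*.

Lemma block_embed M p : block M *m E p = E p *m M p.
Proof.
rewrite mulmx_suml (bigD1 p) //= -!mulmxA embed_isometry mulmx1 big1 ?addr0 //.
by move=> q nqp; rewrite -!mulmxA embed_orthogonal ?mulmx0.
Qed.

Lemma blockM M M' : block M *m block M' = block (fun p => M p *m M' p).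
Proof.
by apply: eq_on_blocks => p; rewrite -mulmxA !block_embed !mulmxA block_embed.
Qed.

Lemma block1 : block (fun=> 1%:M) = 1%:M.
Proof. by apply: eq_on_blocks => p; rewrite block_embed mulmx1 mul1mx. Qed.

Lemma block_adj M : (block M)^t* = block (fun p => (M p)^t*).
Proof.
by rewrite adjmx_sum; apply: eq_bigr => p _; rewrite !adjmxM trmxCK mulmxA.
Qed.

Lemma block_unitary M : (forall p, M p \is unitarymx) -> block M \is unitarymx.
Proof.
move=> Mu; apply/unitarymxP; rewrite block_adj blockM -block1.
by apply: eq_bigr => p _; rewrite (unitarymxP (Mu p)).
Qed.

(** A query leaves the tag alone, so one query serves all branches at once. *)
Lemma query_block c : query R _ c = block (fun p => query R (W p) c).
Proof.
apply: eq_on_blocks => p; rewrite block_embed; apply: eq_on_basis => -[[i b] w].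
by rewrite -!mulmxA !fun_mx_vec.
Qed.

Lemma circuit_block T (U : forall p, concept N -> operator R N (W p)) :
  (forall p, circuit T (U p)) -> circuit T (fun c => block (fun p => U p c)).
Proof.
move=> /fin_all_exists2[u uu uU].
exists (fun t => block (fun p => u p t)) => [t|c]; first exact: block_unitary.
transitivity (block (fun p => run (u p) c T)); last first.
  by apply: eq_bigr => p _; rewrite uU.
by elim: T {uU} => //= T ->; rewrite query_block !blockM.
Qed.

End Blocks.

Lemma ReMreal (R : realType) (k : R) (a : R[i]) :
  complex.Re (k%:C%C * a) = k * complex.Re a.
Proof. by case: a => x y /=; rewrite mul0r subr0. Qed.

(** * Identification by inverting the Hadamard transform *)

Section Identification.

Variables (R : realType) (N : nat) (C : {set concept N}).
Local Notation D := {c : concept N | c \in C}.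

(** Distinct blocks are orthogonal, so only the return amplitude of each branch to its own start
    state is left. *)
Lemma superposition (I : finType) (W : I -> finType)
    (s : forall p, basis N (W p)) (U : forall p, operator R N (W p))
    (J := fun_mx R[i] (fun p => embed (s p))) :
  J^t* *m block U *m J =
  diag_mx (\row_i amplitude (basis_vec R[i] (s (enum_val i))) (U (enum_val i))).
Proof.
have JE k : J *m basis_vec R[i] k =
    fun_mx R[i] (@embed N I W k) *m basis_vec R[i] (s k).
  by rewrite !fun_mx_vec.
have entry (M : 'M[R[i]]_#|I|) i j : M i j =
    ((basis_vec R[i] (enum_val i))^t* *m M *m basis_vec R[i] (enum_val j)) 0 0.
  rewrite /basis_vec !enum_valK trmx_delta map_delta_mx -rowE -colE.
  by rewrite !mxE.
apply/matrixP=> i j; rewrite entry [RHS]mxE [X in _ = X *+ _]mxE.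
rewrite -!mulmxA JE (mulmxA (block U)) block_embed -mulmxA.
rewrite mulmxA -adjmxM JE adjmxM -mulmxA.
rewrite (mulmxA _ (fun_mx R[i] _)).
case: eqVneq => [<-|ij]; first by rewrite embed_isometry mul1mx mulmxA.
by rewrite embed_orthogonal ?(inj_eq enum_val_inj) // mul0mx mulmx0 mxE.
Qed.

Lemma identify (T : nat) :
  C != set0 ->
  (forall p : {ffun D -> bool}, exists (W : finType) (s : basis N W)
     (U : concept N -> operator R N W), circuit T U /\
     forall c, 5 / 6 <= (-1) ^+ p c *
       complex.Re (amplitude (basis_vec R[i] s) (U (val c)))) ->
  computable_with R (fun c : D => c) T.
Proof.
move=> /set0Pn[c0 c0C] algs.
have /fin_all_exists[W] := algs; move=> /fin_all_exists[s] /fin_all_exists[U] UP.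
pose V c := block (fun p => U p c).
have cV : circuit T V by apply: circuit_block => p; case: (UP p).
pose start := fun p => embed (s p).
have start_inj : injective start by move=> p q /embed_tag.
set J := fun_mx R[i] start.
have J1 : J^t* *m J = 1%:M by apply: fun_mx_isometry.
set F := hadamard R[i] D.
pose G := extend_mx J F.
have Gu : G \is unitarymx := extend_mx_unitary J1 (hadamard_unitary _ _).
have GCu : G^t* \is unitarymx by rewrite trmxC_unitary.
have [u uu uV] := circuitMl GCu (circuitMr Gu cV).
pose zero : {ffun D -> bool} := [ffun=> false].
pose single c : {ffun D -> bool} := [ffun d => d == c].
(* Outcomes that encode no concept are announced as the arbitrary [c0]. *)
pose out x := odflt (exist _ c0 c0C : D) [pick c | x == start (single c)].
have outK c : out (start (single c)) = c.
  rewrite /out; case: pickP => [d /eqP/start_inj/ffunP/(_ c)|/(_ c)].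
    by rewrite !ffunE eqxx => /esym/eqP ->.
  by rewrite eqxx.
exists {p : {ffun D -> bool} & W p}, (QAlgorithm (start zero) uu out) => c.
rewrite /output_prob (bigD1 (start (single c))) /=; last by rewrite outK.
rewrite -[leLHS]addr0; apply: lerD; last first.
  by apply: sumr_ge0 => x _; rewrite exprn_ge0.
set z := qstate _ _ _ _ 0.
have GJ : G *m J = J *m F := extend_mxE F J1.
have zE : z = \sum_(p : {ffun D -> bool})
    (-1) ^+ p c / #|{ffun D -> bool}|%:R *
    amplitude (basis_vec R[i] (s p)) (U p (val c)).
  rewrite /z qstateE /= uV -[ket R _]/(basis_vec R[i] (start zero)).
  rewrite -!(fun_mx_vec R[i] start) -/J -!mulmxA (mulmxA G) GJ.
  (* By the adjoint of [GJ], undoing [G] and reading a start state amounts to applying [F^t*] to the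
     coordinates along [J]. *)
  have -> (x : 'cV[R[i]]_#|basis N {p : {ffun D -> bool} & W p}|) :
      (G^t* *m x) (enum_rank (start (single c))) 0 =
      ((basis_vec R[i] (single c))^t* *m (F^t* *m (J^t* *m x))) 0 0.
    rewrite !mulmxA -(mulmxA _ (F^t*)) -adjmxM -GJ adjmxM !mulmxA -adjmxM.
    rewrite fun_mx_vec -mulmxA /basis_vec trmx_delta map_delta_mx -rowE.
    by rewrite [RHS]mxE.
  rewrite -(mulmxA J) (mulmxA (V _)) (mulmxA (J^t*)) (mulmxA (J^t*)).
  rewrite superposition.
  rewrite /basis_vec trmx_delta map_delta_mx -rowE [LHS]mxE mxE -[RHS]sum_enum_val.
  rewrite -colE mul_diag_mx.
  apply: eq_bigr => k _; rewrite -hadamard_mul_conj !mxE enum_valK.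
  by rewrite [RHS]mulrAC -[RHS]mulrA.
have zRe : 5 / 6 <= complex.Re z.
  have nz : #|{ffun D -> bool}|%:R != 0 :> R.
    by rewrite pnatr_eq0 card_ffun card_bool expn_eq0.
  rewrite zE raddf_sum.
  have <- : \sum_(p : {ffun D -> bool}) (5 / 6 / #|{ffun D -> bool}|%:R)
      = 5 / 6 :> R.
    by rewrite sumr_const -[LHS]mulr_natr divfK.
  apply: ler_sum => p _; have [_ /(_ c)] := UP p.
  set a := amplitude _ _ => le_a.
  rewrite (_ : (-1) ^+ _ / _ * a =
    ((-1) ^+ p c / #|{ffun D -> bool}|%:R)%:C%C * a); last first.
    by rewrite rmorphM fmorphV rmorph_nat rmorph_sign.
  rewrite [leRHS](_ : _ = complex.Re
    (((-1) ^+ p c / #|{ffun D -> bool}|%:R)%:C%C * a)) //.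
  by rewrite ReMreal [leRHS]mulrAC ler_wpM2r // invr_ge0.
(* The real part alone gives probability at least 25/36, above 24/36. *)
rewrite -add_Re2_Im2.
have -> : 2 / 3 = (2 / 3)%:C%C :> R[i] by rewrite rmorphM fmorphV !rmorph_nat.
by rewrite lecR; have := sqr_ge0 (complex.Im z); nra.
Qed.

End Identification.

(** * Comparison of the two query complexities *)

Lemma Qcomp_le (R : realType) N (C : {set concept N}) (E : finType)
    (f : {c | c \in C} -> E) T : computable_with R f T -> (Qcomp R f <= T)%N.
Proof.
rewrite /Qcomp => fT; case: pselect => // exT.
by case: ex_minnP => m _; apply; apply/asboolP.
Qed.

Lemma Qcomp_computable (R : realType) N (C : {set concept N}) (E : finType)
    (f : {c | c \in C} -> E) : (0 < N)%N -> C != set0 ->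
  computable_with R f (Qcomp R f).
Proof.
move=> N0 C0; rewrite /Qcomp; case: pselect => [exT|[]].
  by case: ex_minnP => m /asboolP.
by exists N; apply/asboolP/computable_with_N.
Qed.

(* With no query register there is no algorithm: [Qcomp] takes its junk value. *)
Lemma Qcomp0 (R : realType) (C : {set concept 0}) (E : finType)
    (f : {c | c \in C} -> E) : Qcomp R f = 0%N.
Proof.
rewrite /Qcomp; case: pselect => // exT; suff: False by [].
by case: exT => T /asboolP[W [A _]]; case: (qinit A) => [[[]]].
Qed.

(** Relabelling outcomes by [g] can only enlarge the set of correct ones. *)
Lemma computable_with_comp (R : realType) N (C : {set concept N}) (E E' : finType)
    (f : {c | c \in C} -> E) (g : E -> E') T :
  computable_with R f T -> computable_with R (fun c => g (f c)) T.
Proof.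
case=> W [A Af]; exists W, (QAlgorithm (qinit A) (qop_unitary A) (g \o qout A)).
move=> c; apply: le_trans (Af c) _; rewrite /output_prob.
have -> t : qstate (QAlgorithm (qinit A) (qop_unitary A) (g \o qout A)) (val c) t
    = qstate A (val c) t by rewrite !qstateE.
rewrite [leRHS](bigID (fun s => qout A s == f c)) /= [leLHS]big_mkcond /=.
rewrite [X in _ <= X + _]big_mkcond /= -[leLHS]addr0; apply: lerD.
  apply: ler_sum => s _; case: (qout A s =P f c) => [->|]; last by rewrite andbF.
  by rewrite eqxx.
by apply: sumr_ge0 => s _; rewrite exprn_ge0.
Qed.

Lemma Qbool_le_Qclass (R : realType) N (C : {set concept N}) :
  (0 < N)%N -> C != set0 -> (Qbool R C <= Qclass R C)%N.
Proof.
move=> N0 C0; apply/bigmax_leqP => P _.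
exact/Qcomp_le/(computable_with_comp (fun c => c \in P))/Qcomp_computable.
Qed.

Lemma Qclass_le_Qbool (R : realType) N (C : {set concept N}) :
  (0 < N)%N -> C != set0 -> (Qclass R C <= 54 * Qbool R C)%N.
Proof.
move=> N0 C0; apply/Qcomp_le/identify => // p.
pose P := [set c | p c].
have [W [s [U [cU Us]]]] :=
  boolean_circuit (Qcomp_computable R (fun c => c \in P) N0 C0).
exists W, s, U; split=> [|c]; last by have := Us c; rewrite inE.
set T := Qcomp _ _ in cU; set m := Qbool R C.
have Tm : (T <= m)%N.
  exact: (@leq_bigmax _ (fun P : {set _} => Qcomp R (fun c => c \in P))).
(* All branches must make the same number of queries: [27 * (m - T)] cancelling pairs raise [54 * T]
   to [54 * m]. *)
by have := circuit_pad (27 * (m - T)) cU; rewrite mulnA -mulnDr subnK.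
Qed.

Theorem theorem4p1 (R : realType) :
  exists kappa K : R, 0 < kappa /\ 0 < K /\
    forall (N : nat) (C : {set concept N}), C != set0 ->
      kappa * (Qbool R C)%:R <= (Qclass R C)%:R /\
      (Qclass R C)%:R <= K * (Qbool R C)%:R.
Proof.
exists 1, 54; split; first exact: ltr01; split; first by rewrite ltr0n.
move=> [|N] C C0; last first.
  by rewrite mul1r -natrM !ler_nat Qbool_le_Qclass ?Qclass_le_Qbool.
have -> : Qbool R C = 0%N by apply: big1 => P _; apply: Qcomp0.
by rewrite /Qclass Qcomp0 !mulr0.
Qed.
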